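(* Let $n\ge1$ and let $Y_1,\ldots,Y_n$ be i.i.d. random variables having one of the following distributions: (1) uniform on the interval $(0,s)$, for some $s>0$; (2) gamma$(\alpha,\beta)$, for some $\alpha,\beta>0$; (3) any log-normal distribution; (4) the Weibull distribution with parameter $p>0$, whose density is $f(y)=p\,y^{p-1}e^{-y^p}$, $y>0$; (5) the generalized Rayleigh distribution with parameter $\nu>0$, whose density satisfies $f(y)\propto y^{\nu-1}e^{-y^2/2}$, $y>0$. Then for all $a,b\in\mathbf{R}_+^n$, where $\mathbf{R}_+=(0,\infty)$, $$(\log a_1,\ldots,\log a_n)\prec(\log b_1,\ldots,\log b_n)\quad\Longrightarrow\quad\sum_{i=1}^n a_iY_i\le_{\mathrm{st}}\sum_{i=1}^n b_iY_i .$$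
   Context: Usual stochastic order: for real random variables $X,Y$, $X\le_{\mathrm{st}}Y$ means $\Pr(X>t)\le\Pr(Y>t)$ for all $t\in\mathbf{R}$. Majorization: for $a,b\in\mathbf{R}^n$, $a\prec b$ means (i) $\sum_{i=1}^n a_i=\sum_{i=1}^n b_i$ and (ii) $\sum_{i=k}^n a_{(i)}\le\sum_{i=k}^n b_{(i)}$ for $k=2,\ldots,n$, where $a_{(1)}\le\cdots\le a_{(n)}$ and $b_{(1)}\le\cdots\le b_{(n)}$ are the coordinates arranged in increasing order. The gamma$(\alpha,\beta)$ distribution has density proportional to $y^{\alpha-1}e^{-\beta y}$, $y>0$ (since all $\beta>0$ are allowed, it is immaterial whether $\beta$ is regarded as rate or scale). A log-normal variable is $e^Z$ with $Z$ normal with arbitrary mean and positive variance. *)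

(* Defs.v *)
(* MathComp-Analysis *)
From HB Require Import structures.
From mathcomp Require Import all_boot all_order all_algebra.
From mathcomp Require Import all_classical all_reals all_analysis.

Set Implicit Arguments.
Unset Strict Implicit.
Unset Printing Implicit Defensive.

Import Order.TTheory GRing.Theory Num.Theory.
Import numFieldNormedType.Exports.

Local Open Scope classical_set_scope.
Local Open Scope ring_scope.

(* The j-th smallest coordinate a_(j) of a vector, for 1 <= j <= n (the index
   is 1-based, hence the predecessor); equal coordinates are repeated. *)
Definition order_stat (R : realType) (n : nat) (a : 'I_n -> R) (j : nat) : R :=
  nth 0 (sort <=%R [seq a i | i <- enum 'I_n]) j.-1.

Definition majorized (R : realType) (n : nat) (a b : 'I_n -> R) : Prop :=
  \sum_(i < n) a i = \sum_(i < n) b i /\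
  forall k : nat, (2 <= k <= n)%N ->
    \sum_(k <= j < n.+1) order_stat a j <= \sum_(k <= j < n.+1) order_stat b j.

Definition st_le (R : realType)
    (d1 : measure_display) (T1 : measurableType d1) (P1 : probability T1 R)
    (d2 : measure_display) (T2 : measurableType d2) (P2 : probability T2 R)
    (X : {RV P1 >-> R}) (Y : {RV P2 >-> R}) : Prop :=
  forall t : R, (ccdf X t <= ccdf Y t)%E.

Section Iid.
Context (R : realType) (d : measure_display) (T : measurableType d).
Context (P : probability T R) (I : finType).

Definition mutually_independent (Y : I -> {RV P >-> R}) : Prop :=
  forall (J : {set I}) (A : I -> set R), (forall i, measurable (A i)) ->
    P (\bigcap_(i in [set` J]) (Y i @^-1` A i)) =
    (\prod_(i in J) P (Y i @^-1` A i))%E.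

Definition identically_distributed (Y : I -> {RV P >-> R}) : Prop :=
  forall (i j : I) (A : set R), measurable A ->
    distribution P (Y i) A = distribution P (Y j) A.

Definition iid (Y : I -> {RV P >-> R}) : Prop :=
  mutually_independent Y /\ identically_distributed Y.

End Iid.

Section Laws.
Context (R : realType).
Implicit Types (law : set R -> \bar R) (f g : R -> R).

(* Laws are compared on Borel sets only: the set functions of the library are
   total, and their values on other sets carry no meaning. *)
Definition has_density law f : Prop :=
  [/\ measurable_fun setT f, forall y, 0 <= f y &
      forall A : set R, measurable A ->
        law A = (\int[lebesgue_measure]_(y in A) (f y)%:E)%E].

Definition has_density_propto law g : Prop :=
  exists2 c : R, 0 < c & has_density law (fun y => c * g y).

Definition on_pos g : R -> R := fun y => if 0 < y then g y else 0.

(* The library's uniform law lives on [0, s]; the endpoints are null. *)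
Definition is_uniform law : Prop :=
  exists (s : R) (s_gt0 : 0 < s), forall A : set R, measurable A ->
    law A = uniform_prob s_gt0 A.

Definition is_gamma law : Prop :=
  exists alpha beta : R, [/\ 0 < alpha, 0 < beta &
    has_density_propto law
      (on_pos (fun y => y `^ (alpha - 1) * expR (- (beta * y))))].

(* The law of exp Z, where Z is normal with mean m and standard deviation
   sigma. *)
Definition is_lognormal law : Prop :=
  exists m sigma : R, 0 < sigma /\
    forall A : set R, measurable A ->
      law A = pushforward (normal_prob m sigma) expR A.

Definition is_weibull law : Prop :=
  exists2 p : R, 0 < p &
    has_density law
      (on_pos (fun y => p * y `^ (p - 1) * expR (- (y `^ p)))).

Definition is_generalized_rayleigh law : Prop :=
  exists2 nu : R, 0 < nu &
    has_density_propto law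
      (on_pos (fun y => y `^ (nu - 1) * expR (- (y ^+ 2 / 2)))).

End Laws.

(* Main.v *)
(* Passing from b to a, with log a majorized by log b, is a chain of moves that
   bring two log-coordinates closer while keeping their sum, so only two
   coefficients (b1, b2) -> (a1, a2) with a1 * a2 = b1 * b2 and
   max(a1, a2) <= b1 have to change; the rest of the sum is independent and is
   integrated out.  Put k = a2 / b1 <= 1.  The map rho (x, y) = (k y, x / k) is
   a measure preserving involution which exchanges the half-planes
   A = {a1 x + a2 y <= s} and B = {b1 x + b2 y <= s}, and on A \ B the joint
   density f(x) f(y) decreases under rho because k y < x there and f o exp is
   log-concave.  Hence the measure of B \ A is at most that of A \ B. *)
Require Import Defs.
From HB Require Import structures.
From mathcomp Require Import all_boot all_order all_algebra all_fingroup.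
From mathcomp Require Import all_classical all_reals all_analysis.
From mathcomp Require Import measurable_realfun ring lra.

Set Implicit Arguments.
Unset Strict Implicit.
Unset Printing Implicit Defensive.

Import Order.TTheory GRing.Theory Num.Theory.
Import numFieldNormedType.Exports.

Local Open Scope classical_set_scope.
Local Open Scope ring_scope.

(** * Comparison of two coefficients *)

Section Reflection.
Context d (T : measurableType d) (R : realType).
Context (m : {measure set T -> \bar R}).
Local Open Scope ereal_scope.

(** The part over the intersection of [A] and [B] is common to both integrals. Since [rho] preserves
    [m] and swaps the two sets, the integral of [f] over [B] minus [A] equals that of [f \o rho]
    over [A] minus [B], where [f] dominates it. *)
Lemma reflection_le_integral (rho : T -> T) (A B : set T) (f : T -> \bar R) :
  measurable_fun setT rho ->
  (forall C, measurable C -> m (rho @^-1` C) = m C) ->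
  measurable A -> measurable B -> rho @^-1` A = B -> rho @^-1` B = A ->
  measurable_fun [set: T] f -> (forall z, 0 <= f z) ->
  (forall z, A z -> ~ B z -> f (rho z) <= f z) ->
  \int[m]_(z in B) f z <= \int[m]_(z in A) f z.
Proof.
move=> mrho rhom mA mB rhoA rhoB mf f0 frho.
have mf' (C : set T) : measurable_fun C f by exact: measurable_funS mf.
have split (C D : set T) : measurable C -> measurable D ->
    \int[m]_(z in C) f z = \int[m]_(z in C `&` D) f z + \int[m]_(z in C `\` D) f z.
  move=> mC mD; rewrite -ge0_integral_setU ?setUIDK//.
  - exact: measurableI.
  - exact: measurableD.
  - by apply/disj_setPS => z [[_ Dz] [_ nDz]].
rewrite (split B A)// (split A B)// setIC leeD2l//.
have -> : \int[m]_(z in B `\` A) f z = \int[m]_(z in A `\` B) f (rho z).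
  transitivity (\int[pushforward m rho]_(z in B `\` A) f z).
    by apply: eq_measure_integral => C mC _; rewrite /= /pushforward rhom.
  rewrite ge0_integral_pushforward//; last exact: measurableD.
  by rewrite -[rho @^-1` (B `\` A)]/(rho @^-1` B `\` rho @^-1` A) rhoA rhoB.
apply: ge0_le_integral => //; first exact: measurableD.
- by apply: measurable_funS (measurableT_comp mf mrho).
- by move=> z [Az nBz]; exact: frho.
Qed.

End Reflection.

Section DensityMeasure.
Context d (T : measurableType d) (R : realType).
Context (m : {measure set T -> \bar R}).
Context (f : T -> R) (mf : measurable_fun setT f) (f0 : forall x, (0 <= f x)%R).
Local Open Scope ereal_scope.

(** Packaged as a measure below, so that uniqueness of product measures can be applied to it. *)
Definition with_density (A : set T) : \bar R := \int[m]_(x in A) (f x)%:E.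

Let with_density0 : with_density set0 = 0.
Proof. by rewrite /with_density integral_set0. Qed.

Let with_density_ge0 A : 0 <= with_density A.
Proof. by apply: integral_ge0 => x _; rewrite lee_fin. Qed.

Let with_density_sigma_additive : semi_sigma_additive with_density.
Proof.
move=> F mF tF mUF; rewrite /with_density ge0_integral_bigcup//=.
- by apply: is_cvg_ereal_nneg_natsum_cond => k _ _; exact: with_density_ge0.
- by apply/measurable_EFinP; exact: measurable_funS mf.
- by move=> x _; rewrite lee_fin.
Qed.

HB.instance Definition _ := isMeasure.Build _ _ _ with_density
  with_density0 with_density_ge0 with_density_sigma_additive.

Definition density_measure : {measure set T -> \bar R} := with_density.

End DensityMeasure.

Section ProductDensity.
Context d1 d2 (T1 : measurableType d1) (T2 : measurableType d2) (R : realType).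
Context (m1 : {sigma_finite_measure set T1 -> \bar R}).
Context (m2 : {sigma_finite_measure set T2 -> \bar R}).
Local Open Scope ereal_scope.

(** Uniqueness of the product measure reduces this to rectangles, where Tonelli's theorem factors
    the integral. *)
Lemma product_density (p1 : {sigma_finite_measure set T1 -> \bar R})
    (p2 : {sigma_finite_measure set T2 -> \bar R}) (f : T1 -> R) (g : T2 -> R) :
  measurable_fun setT f -> (forall x, 0 <= f x)%R ->
  measurable_fun setT g -> (forall x, 0 <= g x)%R ->
  (forall A, measurable A -> p1 A = \int[m1]_(x in A) (f x)%:E) ->
  (forall A, measurable A -> p2 A = \int[m2]_(x in A) (g x)%:E) ->
  forall C, measurable C ->
    (p1 \x p2) C = \int[m1 \x m2]_(z in C) (f z.1 * g z.2)%:E.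
Proof.
move=> mf f0 mg g0 p1E p2E.
have mh : measurable_fun [set: T1 * T2] (fun z : T1 * T2 => f z.1 * g z.2)%R.
  apply: measurable_funM.
    exact: (measurableT_comp mf).
  exact: (measurableT_comp mg).
have h0 (z : T1 * T2) : (0 <= f z.1 * g z.2)%R by exact: mulr_ge0.
apply: (product_measure_unique (m' := density_measure (m1 \x m2) mh h0)).
move=> A B mA mB; rewrite /= /with_density p1E// p2E//.
have mAB : measurable (A `*` B) by exact: measurableX.
rewrite integral_mkcond fubini_tonelli1/=; last 2 first.
- apply/(measurable_restrictT _ mAB)/measurable_EFinP.
  exact: measurable_funS mh.
- by apply: erestrict_ge0 => z _; rewrite lee_fin.
rewrite [X in X * _]integral_mkcond.
rewrite -ge0_integralZr//=; last 3 first.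
- apply/(measurable_restrictT _ mA)/measurable_EFinP.
  exact: measurable_funS mf.
- by move=> x _; apply: erestrict_ge0 => z _; rewrite lee_fin.
- by apply: integral_ge0 => z _; rewrite lee_fin.
apply: eq_integral => x _; rewrite /fubini_F/=.
rewrite [in RHS]patchE; case: ifPn => xA; last first.
  rewrite mul0e integral0_eq// => y _; rewrite patchE.
  by rewrite in_setX/= (negPf xA).
rewrite -ge0_integralZl//=; last 3 first.
- by apply/measurable_EFinP; exact: measurable_funS mg.
- by move=> y _; rewrite lee_fin.
- by rewrite lee_fin.
rewrite [RHS]integral_mkcond; apply: eq_integral => y _.
by rewrite !patchE in_setX/= xA/= EFinM.
Qed.

End ProductDensity.

Section TwoVariables.
Context (R : realType).
Context (m : {sigma_finite_measure set R -> \bar R}).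
Local Open Scope ereal_scope.

(* For f supported on the positive axis this says that u |-> f (exp u) is
   log-concave. *)
Definition mul_log_concave (f : R -> R) : Prop :=
  forall k x y : R, (0 < k <= 1 -> k * y < x ->
    f (k * y) * f (x / k) <= f x * f y)%R.

(* Holds both for Lebesgue measure and for its image under exp; it makes
   (x, y) |-> (k y, x / k) preserve the product measure. *)
Definition dilation_balanced : Prop :=
  forall (k : R) (A B : set R), (0 < k)%R -> measurable A -> measurable B ->
    m ( *%R k @^-1` A) * m ( *%R k^-1%R @^-1` B) = m A * m B.

Lemma sum2_le (f : R -> R) (p : {sigma_finite_measure set R -> \bar R})
    (q : {sigma_finite_measure set R -> \bar R}) (a1 a2 b1 b2 s : R) :
  dilation_balanced ->
  measurable_fun setT f -> (forall x, 0 <= f x)%R -> mul_log_concave f ->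
  (forall A, measurable A -> p A = \int[m]_(x in A) (f x)%:E) ->
  (forall A, measurable A -> q A = \int[m]_(x in A) (f x)%:E) ->
  (0 < a2)%R -> (0 < b1)%R ->
  (a1 * a2 = b1 * b2)%R -> (a1 <= b1)%R -> (a2 <= b1)%R ->
  (p \x q) [set z | (b1 * z.1 + b2 * z.2 <= s)%R] <=
  (p \x q) [set z | (a1 * z.1 + a2 * z.2 <= s)%R].
Proof.
move=> bal mf f0 lf pE qE a20 b10 ab ab1 ab2.
have mset (c1 c2 : R) : measurable [set z : R * R | (c1 * z.1 + c2 * z.2 <= s)%R].
  rewrite -[X in measurable X]setTI.
  have mc : measurable_fun [set: R * R] (fun z : R * R => (c1 * z.1 + c2 * z.2)%R).
    by apply: measurable_funD; apply: measurable_funM => //.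
  have := mc measurableT _ (measurable_itv `]-oo, s]%R).
  by congr (measurable (_ `&` _)); apply/seteqP; split => z /=; rewrite in_itv.
rewrite !(product_density mf f0 mf f0 pE qE)//.
(* With [k = a2 / b1], the equality of products forces [b2 = k * a1], so [rho] below carries one
   linear form to the other. *)
have [k [k0 k1 a2E b2E]] : exists k : R,
    [/\ (0 < k)%R, (k <= 1)%R, a2 = (k * b1)%R & b2 = (k * a1)%R].
  have b1n0 : b1 != 0%R by rewrite gt_eqF.
  exists (a2 / b1)%R; split; rewrite ?divr_gt0 ?ler_pdivrMr ?mul1r ?divfK//.
  by rewrite mulrAC (mulrC a2) ab mulrAC mulfV// mul1r.
have kn0 : k != 0%R by rewrite gt_eqF.
pose rho (z : R * R) : R * R := (k * z.2, k^-1 * z.1)%R.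
have mrho : measurable_fun setT rho.
  by apply: measurable_fun_pair; apply: measurable_funM.
apply: (@reflection_le_integral _ _ _ _ rho) => //.
(* The preimage of a rectangle under [rho] is a rectangle with its sides exchanged and dilated by
   reciprocal factors, so [dilation_balanced] gives invariance. *)
- move=> C mC; apply/esym.
  apply: (product_measure_unique (m' := pushforward (m \x m)%E rho)) => // A B mA mB.
  transitivity ((m \x m) (( *%R k^-1%R @^-1` B) `*` ( *%R k @^-1` A))).
    by rewrite /= /pushforward; congr (product_measure1 _ _ _); apply/seteqP; split => z /= [].
  have mk c (D : set R) : measurable D -> measurable ( *%R c @^-1` D).
    move=> mD; rewrite -[X in measurable X]setTI.
    by apply: (measurable_funM (f := cst c)) => //.
  by rewrite product_measure1E; [rewrite muleC bal|exact: mk..].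
- apply: eq_set => z; rewrite /rho/=.
  by congr (is_true (_ <= s)%R); rewrite a2E b2E; field.
- apply: eq_set => z; rewrite /rho/=.
  by congr (is_true (_ <= s)%R); rewrite a2E b2E; field.
- apply/measurable_EFinP; apply: measurable_funM.
    exact: (measurableT_comp mf).
  exact: (measurableT_comp mf).
- by move=> z; rewrite lee_fin mulr_ge0.
- move=> z /= zA /negP; rewrite -ltNge => zB.
  rewrite lee_fin (mulrC k^-1%R); apply: lf; first by rewrite k0.
  (* The form with coefficients [a] exceeds the one with coefficients [b] by
     [(b1 - a1) * (k * z.2 - z.1)]. Thus [z.1 <= k * z.2] would put [z] in both half-planes. *)
  rewrite ltNge; apply/negP => zk.
  have : ((b1 - a1) * z.1 <= (b1 - a1) * (k * z.2))%R.
    by apply: ler_wpM2l => //; rewrite subr_ge0.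
  move: zA zB; rewrite a2E b2E => zA zB; apply/negP; rewrite -ltNge.
  by rewrite -subr_gt0; nra.
Qed.

End TwoVariables.
(** * Joint laws of independent variables *)

Section ProductMeasurable.
Context d1 d2 (T1 : measurableType d1) (T2 : measurableType d2) (R : realType).
Local Open Scope ereal_scope.

(** Rectangles form a pi-system generating the product sigma-algebra, and finiteness of [m] lets the
    whole space serve as the exhausting sequence. *)
Lemma measure_prod_ext (m m' : {measure set (T1 * T2) -> \bar R}) :
  m setT < +oo ->
  (forall A B, measurable A -> measurable B -> m (A `*` B) = m' (A `*` B)) ->
  forall C, measurable C -> m C = m' C.
Proof.
move=> moo mm' C mC.
apply: (measure_unique [set A `*` B | A in measurable & B in measurable]
  (fun=> setT)) => //.
- exact: measurable_prod_measurableType.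
- move=> _ _ [A1 mA1 [A2 mA2 <-]] [B1 mB1 [B2 mB2 <-]].
  rewrite -setXI; exists (A1 `&` B1); first exact: measurableI.
  by exists (A2 `&` B2) => //; exact: measurableI.
- by move=> _; exists setT => //; exists setT => //; rewrite setXTT.
- by rewrite bigcup_const.
- by move=> _ [A mA [B mB <-]]; exact: mm'.
Qed.

End ProductMeasurable.

Lemma measurable_preimageT d1 d2 (T1 : measurableType d1) (T2 : measurableType d2)
    (f : T1 -> T2) (A : set T2) :
  measurable_fun setT f -> measurable A -> measurable (f @^-1` A).
Proof. by move=> mf mA; rewrite -[X in measurable X]setTI; exact: mf. Qed.

Section Independence.
Context d (T : measurableType d) (R : realType) (P : probability T R).
Local Open Scope ereal_scope.

(** Both sides are finite measures in [C]: the law of the pair under [P] restricted to [V], and its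
    law under [P] scaled by [P V]. They agree on rectangles, hence everywhere. *)
Lemma joint_indep_event d1 d2 (T1 : measurableType d1) (T2 : measurableType d2)
    (X1 : T -> T1) (X2 : T -> T2) (V : set T) :
  measurable_fun setT X1 -> measurable_fun setT X2 -> measurable V ->
  (forall A B, measurable A -> measurable B ->
    P (X1 @^-1` A `&` X2 @^-1` B `&` V) = P (X1 @^-1` A `&` X2 @^-1` B) * P V) ->
  forall C, measurable C ->
    P ((fun w => (X1 w, X2 w)) @^-1` C `&` V) =
    P ((fun w => (X1 w, X2 w)) @^-1` C) * P V.
Proof.
move=> mX1 mX2 mV indep C mC.
have mX : measurable_fun setT (fun w => (X1 w, X2 w)).
  exact: measurable_fun_pair.
have PV0 : (0 <= fine (P V))%R by rewrite fine_ge0.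
have PVE : (fine (P V))%:E = P V by rewrite fineK// fin_num_measure.
have := @measure_prod_ext _ _ _ _ _ (pushforward (mrestr P mV) (fun w => (X1 w, X2 w)))
  (mscale (NngNum PV0) (pushforward P (fun w => (X1 w, X2 w)))) _ _ C mC.
rewrite /= /mscale /= PVE muleC; apply => //.
- rewrite /pushforward /mrestr preimage_setT setTI.
  by rewrite ltey_eq fin_num_measure.
- by move=> A B mA mB; rewrite muleC; exact: indep.
Qed.

Context (I : finType) (Y : I -> {RV P >-> R}) (c : I -> R).
Hypothesis indepY : mutually_independent Y.

(** Indexed by a list, so that independence can be proved by adding one variable at a time. *)
Definition lin_comb (s : seq I) (w : T) : R := (\sum_(i <- s) c i * Y i w)%R.

Lemma measurable_lin_comb s : measurable_fun setT (lin_comb s).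
Proof. by apply: measurable_sum => i; exact: measurable_funM. Qed.

Definition cylinder (J : {set I}) (A : I -> set R) : set T :=
  \bigcap_(i in [set` J]) (Y i @^-1` A i).

Lemma measurable_cylinder J A : (forall i, measurable (A i)) ->
  measurable (cylinder J A).
Proof.
move=> mA; apply: fin_bigcap_measurable => [|i _]; first exact: finite_finset.
exact: measurable_preimageT.
Qed.

Lemma cylinderU1 (k : I) (J : {set I}) A (B : set R) : k \notin J ->
  cylinder (k |: J) (fun i => if i == k then B else A i) =
  Y k @^-1` B `&` cylinder J A.
Proof.
move=> kJ; apply/seteqP; split => [w cw|w [Bw cw] i /=].
  split; first by have := cw k; rewrite /= eqxx; apply; rewrite setU11.
  move=> i /= iJ; have := cw i; rewrite /= !inE iJ orbT => /(_ isT).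
  by case: eqP => // ik; rewrite -ik iJ in kJ.
rewrite !inE; case: eqP => [-> _|_ /= iJ]; first exact: Bw.
exact: cw.
Qed.

(** Induction on [s], for all [J] and [A] at once. The sum over [k :: s] is a function of [Y k] and
    the sum over [s]; on rectangles the constraint on [Y k] joins the cylinder, which becomes one
    over [k |: J], and the induction hypothesis applies. *)
Lemma lin_comb_indep (s : seq I) : uniq s ->
  forall (J : {set I}) (B : set R) (A : I -> set R),
    {in s, forall i, i \notin J} -> measurable B -> (forall i, measurable (A i)) ->
    P (lin_comb s @^-1` B `&` cylinder J A) =
    P (lin_comb s @^-1` B) * \prod_(i in J) P (Y i @^-1` A i).
Proof.
elim: s => [_ J B A _ mB mA|k s IH /= /andP[ks us] J B A sJ mB mA].
  (* The empty sum is the constant 0, so its event is everything or nothing. *)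
  have -> : lin_comb [::] @^-1` B = if 0%R \in B then setT else set0.
    apply/seteqP; rewrite /lin_comb /preimage; under eq_set do rewrite big_nil.
    by case: ifPn; rewrite ?inE ?notin_setE; split.
  case: ifP => _; last by rewrite set0I measure0 mul0e.
  by rewrite setTI probability_setT mul1e; exact: indepY.
have kJ : k \notin J by apply: sJ; rewrite mem_head.
have sJ' : {in s, forall i, i \notin J}.
  by move=> i si; apply: sJ; rewrite in_cons si orbT.
have PV : P (cylinder J A) = \prod_(i in J) P (Y i @^-1` A i) by exact: indepY.
rewrite -PV.
pose C := [set z : R * R | B (c k * z.1 + z.2)%R].
have mC : measurable C.
  apply: (@measurable_preimageT _ _ _ _ (fun z : R * R => c k * z.1 + z.2)%R) => //.
  by apply: measurable_funD => //; exact: measurable_funM.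
have CE : lin_comb (k :: s) @^-1` B = (fun w => (Y k w, lin_comb s w)) @^-1` C.
  by apply: eq_set => w /=; rewrite /lin_comb big_cons.
rewrite CE; apply: joint_indep_event => //.
- exact: measurable_lin_comb.
- exact: measurable_cylinder.
move=> A1 A2 mA1 mA2.
have mA' (D : I -> set R) : (forall i, measurable (D i)) ->
    forall i, measurable (if i == k then A1 else D i).
  by move=> mD i; case: ifP.
have ID (K : {set I}) (D : I -> set R) : k \notin K -> {in s, forall i, i \notin K} ->
    (forall i, measurable (D i)) ->
    P (Y k @^-1` A1 `&` lin_comb s @^-1` A2 `&` cylinder K D) =
    P (lin_comb s @^-1` A2) * (P (Y k @^-1` A1) * \prod_(i in K) P (Y i @^-1` D i)).
  move=> kK sK mD.
  rewrite -setIA setICA -cylinderU1// IH//; last 2 first.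
  - by move=> i si; rewrite !inE negb_or sK// andbT; apply: contraNneq ks => <-.
  - exact: mA'.
  rewrite big_setU1//= eqxx; congr (_ * (_ * _)); apply: eq_bigr => i iK.
  by case: eqP => // ik; rewrite -ik iK in kK.
(* The empty index set gives the probability of the rectangle alone; [J] gives its intersection with
   the cylinder. *)
have := ID finset.set0 (fun=> setT).
rewrite /cylinder big_set0 mule1.
have -> : \bigcap_(i in [set` @finset.set0 I]) (Y i @^-1` setT) = setT.
  by apply/seteqP; split => // w _ i /=; rewrite inE.
rewrite setIT => -> //; last 2 first.
- by rewrite inE.
- by move=> i _; rewrite inE.
by rewrite ID// PV muleA.
Qed.

Lemma cylinder2 (i j : I) (B1 B2 : set R) : i != j ->
  cylinder [set i; j] (fun k => if k == i then B1 else B2) =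
  Y i @^-1` B1 `&` Y j @^-1` B2.
Proof.
move=> ij; rewrite (cylinderU1 (fun=> B2)) ?inE//; congr (_ `&` _).
apply/seteqP; split => [w /(_ j)|w Bw k /=]; first by rewrite /= inE eqxx; exact.
by rewrite inE => /eqP ->.
Qed.

Lemma rect_law (s : seq I) (i j : I) (A B1 B2 : set R) :
  uniq s -> i \notin s -> j \notin s -> i != j ->
  measurable A -> measurable B1 -> measurable B2 ->
  P (lin_comb s @^-1` A `&` (Y i @^-1` B1 `&` Y j @^-1` B2)) =
  P (lin_comb s @^-1` A) * (P (Y i @^-1` B1) * P (Y j @^-1` B2)).
Proof.
move=> us si sj ij mA mB1 mB2; rewrite -cylinder2// lin_comb_indep//; last 2 first.
- move=> k sk; rewrite !inE negb_or.
  by apply/andP; split; [apply: contraNneq si|apply: contraNneq sj] => <-.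
- by move=> k; case: ifP.
by rewrite big_setU1 ?inE//= big_set1 eqxx eq_sym (negPf ij).
Qed.

Lemma pair_rect (i j : I) (B1 B2 : set R) : i != j ->
  measurable B1 -> measurable B2 ->
  P (Y i @^-1` B1 `&` Y j @^-1` B2) = P (Y i @^-1` B1) * P (Y j @^-1` B2).
Proof.
move=> ij mB1 mB2; rewrite -cylinder2// indepY; last by move=> k; case: ifP.
by rewrite big_setU1 ?inE//= big_set1 eqxx eq_sym (negPf ij).
Qed.

Definition pair_rv (i j : I) (w : T) : R * R := (Y i w, Y j w).

Lemma measurable_pair_rv i j : measurable_fun setT (pair_rv i j).
Proof. exact: measurable_fun_pair. Qed.

Lemma pair_law (i j : I) : i != j -> forall C : set (R * R), measurable C ->
  P (pair_rv i j @^-1` C) = (distribution P (Y i) \x distribution P (Y j)) C.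
Proof.
move=> ij C mC; apply/esym; have mYY := measurable_pair_rv i j.
apply: (product_measure_unique (m' := pushforward P (pair_rv i j))) => //.
by move=> B1 B2 mB1 mB2; exact: pair_rect.
Qed.

(** This makes the rest of the sum independent of the pair. [rect_law] only treats boxes in the
    plane; [joint_indep_event], with the event on [lin_comb s] as [V], extends it to all Borel sets
    of pairs. *)
Lemma triple_law (s : seq I) (i j : I) : uniq s -> i \notin s -> j \notin s ->
  i != j -> forall C : set (R * (R * R)), measurable C ->
  P ((fun w => (lin_comb s w, pair_rv i j w)) @^-1` C) =
  (pushforward P (lin_comb s) \x pushforward P (pair_rv i j)) C.
Proof.
move=> us si sj ij C mC.
have mS := measurable_lin_comb s.
have mYY := measurable_pair_rv i j.
pose S : {mfun T >-> R} := HB.pack (lin_comb s) (isMeasurableFun.Build _ _ _ _ _ mS).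
pose YY : {mfun T >-> (R * R)%type} :=
  HB.pack (pair_rv i j) (isMeasurableFun.Build _ _ _ _ _ mYY).
have mSYY : measurable_fun setT (fun w => (lin_comb s w, pair_rv i j w)).
  exact: measurable_fun_pair.
apply/esym; apply: (@product_measure_unique _ _ _ _ _ (distribution P S)
  (distribution P YY)
  (pushforward P (fun w => (lin_comb s w, pair_rv i j w)))) => // A B mA mB.
rewrite -[RHS]/(P (lin_comb s @^-1` A) * P (pair_rv i j @^-1` B)) muleC.
rewrite -joint_indep_event//.
- by rewrite setIC.
- exact: measurable_preimageT.
- by move=> B1 B2 mB1 mB2; rewrite setIC rect_law// muleC pair_rect.
Qed.

End Independence.
(** * Majorization as a chain of two-coordinate transfers *)

Section Majorization.
Context (R : realType) (n : nat).
Implicit Types (x y u v : 'I_n -> R).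

(** Here [x] comes from [y] by moving two coordinates closer, [y i] being the larger. The
    inequalities are weak, so exchanging the two coordinates is also allowed. *)
Definition transfer_monotone (G : ('I_n -> R) -> \bar R) : Prop :=
  forall (i j : 'I_n) x y, i != j ->
    (forall k, k != i -> k != j -> x k = y k) ->
    x i + x j = y i + y j -> x i <= y i -> x j <= y i -> (G y <= G x)%E.

Lemma sum_ord_delta (m : nat) (c : R) (j : 'I_n) :
  \sum_(i < n | (i < m)%N) c *+ (i == j) = c *+ (j < m).
Proof.
rewrite big_mkcond (bigD1 j)//= eqxx big1 ?addr0; first by case: ifP.
by move=> i /negPf ->; case: ifP.
Qed.

Lemma sum_ord_lt (m : nat) (x : 'I_n -> R) : (n <= m)%N ->
  \sum_(i < n | (i < m)%N) x i = \sum_(i < n) x i.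
Proof. by move=> nm; apply: eq_bigl => i; rewrite (leq_trans _ nm). Qed.

(** Induction on the number of coordinates where [u] and [v] differ: each transfer settles at least
    one of them and keeps the prefix inequalities. Only [u] is assumed sorted, since the
    intermediate vectors may lose their order. *)
Lemma transfer_chain (G : ('I_n -> R) -> \bar R) (u v : 'I_n -> R) :
  transfer_monotone G ->
  {homo u : i j / (i <= j)%N >-> i <= j} ->
  (forall m, \sum_(i < n | (i < m)%N) v i <= \sum_(i < n | (i < m)%N) u i) ->
  \sum_(i < n) u i = \sum_(i < n) v i ->
  (G v <= G u)%E.
Proof.
move=> HG hu.
have [N] := ubnP #|[pred i | u i != v i]|.
elim: N v => // N IH v ltN hpre htot.
have [/existsP[i0 hi0]|] := boolP [exists k : 'I_n, u k < v k]; last first.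
  rewrite negb_exists => /forallP le_vu.
  have hle i : v i <= u i by rewrite leNgt.
  suff -> : v = u by [].
  apply/funext => i; apply/eqP; rewrite eq_sym -subr_eq0.
  have : \sum_(i < n) (u i - v i) = 0 by rewrite sumrB htot subrr.
  move/eqP; rewrite psumr_eq0; last by move=> k _; rewrite subr_ge0.
  by move/allP => /(_ i); rewrite mem_index_enum => /(_ isT).
case: (@arg_minnP _ i0 [pred k | u k < v k] (fun k => k : nat) hi0) => k huv kmin.
move: huv => /= huv.
have lek (i : 'I_n) : (i < k)%N -> v i <= u i.
  by move=> ik; rewrite leNgt; apply/negP => /(kmin i); rewrite leqNgt ik.
(* Without such a [j], [v] and [u] would agree before [k], and the prefix sum of [v] through [k]
   would be too large. *)
have [/existsP[j /andP[jk hj]]|] := boolP [exists j : 'I_n, (j < k)%N && (v j < u j)];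
    last first.
  rewrite negb_exists => /forallP hno.
  have := hpre k.+1; rewrite (bigD1 k)//= [leRHS](bigD1 k)//=.
  suff -> : \sum_(i < n | (i < k.+1)%N && (i != k)) v i =
            \sum_(i < n | (i < k.+1)%N && (i != k)) u i.
    by rewrite lerD2r leNgt huv.
  apply: eq_bigr => i /andP[ik nik].
  have {}ik : (i < k)%N by rewrite ltn_neqAle nik -ltnS.
  apply/eqP; rewrite eq_le lek//=.
  by have := hno i; rewrite ik/= -leNgt.
have njk : j != k by apply/eqP => e; rewrite e ltnn in jk.
(* The largest amount that can move from [k] to [j] without overshooting either target; the one
   attaining the minimum is then settled. *)
pose D := Num.min (u j - v j) (v k - u k).
have D1 : D <= u j - v j by rewrite ge_min lexx.
have D2 : D <= v k - u k by rewrite ge_min lexx orbT.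
have D0 : 0 < D by rewrite lt_min !subr_gt0 hj huv.
pose w i := v i + D *+ (i == j) - D *+ (i == k).
have wj : w j = v j + D by rewrite /w eqxx (negPf njk) subr0.
have wk : w k = v k - D by rewrite /w eqxx eq_sym (negPf njk) addr0.
have wo i : i != k -> i != j -> w i = v i.
  by move=> /negPf h1 /negPf h2; rewrite /w h1 h2 subr0 addr0.
have ujk : u j <= u k by apply: hu; exact: ltnW.
have sumw m : \sum_(i < n | (i < m)%N) w i =
    \sum_(i < n | (i < m)%N) v i + D *+ (j < m) - D *+ (k < m).
  by rewrite sumrB big_split/= !sum_ord_delta.
(* Sortedness enters here: [w j <= u j <= u k <= w k <= v k]. *)
have le_vw : (G v <= G w)%E.
  apply: (HG k j) => //; first by rewrite eq_sym.
  - by rewrite wj wk; lra.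
  - by rewrite wk; lra.
  - by rewrite wj; lra.
apply: (le_trans le_vw); apply: IH.
- rewrite -ltnS; apply: leq_trans ltN; rewrite ltnS.
  apply: proper_card; apply/properP; split.
    apply/fintype.subsetP => i; rewrite !inE; apply: contra => /eqP e.
    have [ik|nik] := eqVneq i k; first by move: huv; rewrite -ik e ltxx.
    have [ij|nij] := eqVneq i j; first by move: hj; rewrite -ij e ltxx.
    by rewrite wo// e.
  have [DE|DE] : D = u j - v j \/ D = v k - u k.
    by rewrite /D minEle; case: ifP; [left|right].
  + exists j; rewrite !inE; first by rewrite gt_eqF.
    by rewrite wj DE addrC subrK eqxx.
  + exists k; rewrite !inE; first by rewrite lt_eqF.
    by rewrite wk DE opprB addrC subrK eqxx.
(* Only prefixes with [j < m <= k] change. They gain [D <= u j - v j], and their other coordinates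
   satisfy [v i <= u i] by minimality of [k]. *)
- move=> m; rewrite sumw.
  have [km|mk] := ltnP k m.
    by rewrite (ltn_trans jk km) addrK.
  have [jm|mj] := ltnP j m; last by rewrite addr0 subr0.
  rewrite subr0 (bigD1 j)//= [leRHS](bigD1 j)//= mulr1n.
  suff : \sum_(i < n | (i < m)%N && (i != j)) v i <=
         \sum_(i < n | (i < m)%N && (i != j)) u i by lra.
  by apply: ler_sum => i /andP[im _]; apply: lek; exact: leq_trans mk.
- by have := sumw n; rewrite !sum_ord_lt// !ltn_ord addrK htot => ->.
Qed.

(** A transposition is a transfer, read from the larger of the two coordinates, and transpositions
    generate all permutations. The inverse permutation gives the opposite inequality. *)
Lemma transfer_perm (G : ('I_n -> R) -> \bar R) (s : 'S_n) x :
  transfer_monotone G -> G (x \o s) = G x.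
Proof.
move=> HG.
have Gt i j y : (G y <= G (y \o tperm i j))%E.
  have [->|nij] := eqVneq i j.
    suff -> : y \o tperm j j = y by [].
    by apply/funext => k /=; rewrite tperm1 perm1.
  have [le_ij|/ltW le_ji] := leP (y j) (y i).
    apply: (HG i j) => //=; rewrite ?tpermL ?tpermR//.
      by move=> k ki kj; rewrite tpermD// eq_sym.
    exact: addrC.
  apply: (HG j i) => //=; rewrite ?tpermL ?tpermR//; first by rewrite eq_sym.
    by move=> k ki kj; rewrite tpermD// eq_sym.
  exact: addrC.
have Gle (p : 'S_n) y : (G y <= G (y \o p))%E.
  have [ts -> _] := prod_tpermP p.
  elim: ts y => [|t ts IH] y.
    rewrite big_nil; suff -> : y \o (1%g : 'S_n) = y by [].
    by apply/funext => k /=; rewrite perm1.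
  apply: (le_trans (IH y)); rewrite big_cons.
  suff -> : y \o (tperm t.1 t.2 * \prod_(t <- ts) tperm t.1 t.2)%g =
      (y \o (\prod_(t <- ts) tperm t.1 t.2)%g) \o tperm t.1 t.2 by exact: Gt.
  by apply/funext => k /=; rewrite permM.
apply/eqP; rewrite eq_le Gle andbT.
suff {2}-> : x = (x \o s) \o (s^-1)%g by exact: Gle.
by apply/funext => k /=; rewrite permKV.
Qed.

(** The permutation sorting [x]; the successor reconciles ordinals counted from 0 with ranks counted
    from 1. *)
Lemma order_stat_perm x : exists2 s : 'S_n,
  (forall i : 'I_n, order_stat x i.+1 = x (s i)) &
  {homo x \o s : i j / (i <= j)%N >-> i <= j}.
Proof.
pose t := [tuple x i | i < n].
have : perm_eq (sort <=%R t) t by rewrite perm_sort.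
case/tuple_permP => s sE.
have osE (i : 'I_n) : order_stat x i.+1 = x (s i).
  rewrite /order_stat /= -[[seq x i | i <- enum 'I_n]]/(val t) sE.
  by rewrite (nth_map i) ?size_enum_ord// nth_ord_enum tnth_mktuple.
exists s => // i j ij; rewrite /= -!osE /order_stat /=.
have st : sorted <=%R (sort <=%R [seq x i | i <- enum 'I_n]).
  by apply: sort_sorted; exact: le_total.
apply: (sorted_leq_nth le_trans lexx 0 st) => //;
  by rewrite inE size_sort size_map size_enum_ord.
Qed.

(** Permutation invariance allows both vectors to be sorted. As the totals agree, the bounds on
    suffix sums become the reverse bounds on prefix sums. *)
Lemma majorized_le (G : ('I_n -> R) -> \bar R) (x y : 'I_n -> R) :
  transfer_monotone G -> majorized x y -> (G y <= G x)%E.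
Proof.
move=> HG [tot maj].
have [s sE shomo] := order_stat_perm x.
have [r rE _] := order_stat_perm y.
rewrite -(transfer_perm s x HG) -(transfer_perm r y HG).
have sumperm (p : 'S_n) (z : 'I_n -> R) :
    \sum_(i < n) (z \o p) i = \sum_(i < n) z i.
  by rewrite [RHS](reindex_inj (@perm_inj _ p)).
have tot' : \sum_(i < n) (x \o s) i = \sum_(i < n) (y \o r) i.
  by rewrite !sumperm.
apply: transfer_chain => // m.
(* Full and empty prefixes lie outside the range of the majorization inequalities; they follow from
   the equal totals and from empty sums. *)
have [n_le_m|m_lt_n] := leqP n m.
  by rewrite !sum_ord_lt// tot'.
have [->|m_gt0] := posnP m; first by rewrite !big_pred0.
have suffix (z : 'I_n -> R) (p : 'S_n) :
    (forall i : 'I_n, order_stat z i.+1 = z (p i)) ->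
    \sum_(m.+1 <= j < n.+1) order_stat z j =
    \sum_(i < n | ~~ (i < m)%N) (z \o p) i.
  move=> zE; rewrite big_add1/= big_geq_mkord/=.
  by apply: eq_big => [i|i _]; rewrite -?leqNgt// zE.
have := maj m.+1; rewrite ltnS m_gt0 => /(_ m_lt_n).
rewrite (suffix _ _ sE) (suffix _ _ rE).
move: tot'; rewrite (bigID (fun i : 'I_n => (i < m)%N))/=.
rewrite [RHS](bigID (fun i : 'I_n => (i < m)%N))/=.
lra.
Qed.

End Majorization.
(** * Log-concave laws *)

Section ReferenceMeasure.
Context (R : realType) (phi : measurableTypeR R -> R) (psi : R -> R).
Hypotheses (mphi : measurable_fun setT phi) (mpsi : measurable_fun setT psi).
Hypothesis phiK : cancel phi psi.
Local Open Scope ereal_scope.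

(** Used with [phi] the identity and with [phi] the exponential; the left inverse [psi] serves to
    show sigma-finiteness. *)
Definition image_lebesgue : set R -> \bar R := pushforward lebesgue_measure phi.

Let image_lebesgue0 : image_lebesgue set0 = 0.
Proof. by rewrite /image_lebesgue /pushforward preimage_set0 measure0. Qed.

Let image_lebesgue_ge0 A : 0 <= image_lebesgue A.
Proof. exact: measure_ge0. Qed.

Let image_lebesgue_sigma_additive : semi_sigma_additive image_lebesgue.
Proof.
exact: (@measure_semi_sigma_additive _ _ _ (pushforward lebesgue_measure phi)).
Qed.

HB.instance Definition _ := isMeasure.Build _ _ _ image_lebesgue
  image_lebesgue0 image_lebesgue_ge0 image_lebesgue_sigma_additive.

Let image_lebesgue_sigma_finite : sigma_finite setT image_lebesgue.
Proof.
exists (fun n : nat => psi @^-1` `[(- n%:R)%R, n%:R%R]%classic).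
  apply/seteqP; split => // x _.
  exists (Num.truncn `|psi x|).+1 => //=.
  by rewrite in_itv /= -ler_norml ltW// truncnS_gt.
move=> n; split; first exact: measurable_preimageT.
rewrite /image_lebesgue /pushforward.
have -> : phi @^-1` (psi @^-1` `[(- n%:R)%R, n%:R%R]%classic) = `[(- n%:R)%R, n%:R%R]%classic.
  by apply: eq_set => u /=; rewrite phiK.
by rewrite lebesgue_measure_itv /=; case: ifP => _; rewrite -?EFinD ltry.
Qed.

HB.instance Definition _ := Measure_isSigmaFinite.Build _ _ _ image_lebesgue
  image_lebesgue_sigma_finite.

Definition reference_measure : {sigma_finite_measure set R -> \bar R} :=
  image_lebesgue.

Lemma integral_reference_measure (A : set R) (f : R -> R) :
  measurable A -> measurable_fun setT f -> (forall x, 0 <= f x)%R ->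
  \int[reference_measure]_(x in A) (f x)%:E =
  \int[lebesgue_measure]_(u in phi @^-1` A) (f (phi u))%:E.
Proof.
move=> mA mf f0; rewrite [LHS]ge0_integral_pushforward//.
- by apply/measurable_EFinP; exact: measurable_funS mf.
- by move=> x _; rewrite lee_fin.
Qed.

End ReferenceMeasure.

Section Invariance.
Context (R : realType).
Local Open Scope ereal_scope.
Local Notation mu := (@lebesgue_measure R).

Lemma lebesgue_measure_translation (c : R) (A : set R) : measurable A ->
  mu ((fun u => u + c)%R @^-1` A) = mu A.
Proof.
move=> mA; apply/esym.
have mf : measurable_fun [set: measurableTypeR R]
    (fun u : measurableTypeR R => (u + c)%R : measurableTypeR R).
  exact: measurable_funD.
apply: (lebesgue_measure_unique
  (mu := pushforward mu (fun u : measurableTypeR R => (u + c)%R : measurableTypeR R))) => //.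
move=> _ [[a b]] _ <-; rewrite /= /pushforward.
have -> : (fun u => u + c)%R @^-1` `]a, b]%classic = `](a - c)%R, (b - c)%R]%classic.
  by apply: eq_set => u /=; rewrite !in_itv /= ltrBlDr lerBrDr.
rewrite !lebesgue_measure_itv /= !lte_fin ltrD2r.
by case: ifP => // _; rewrite -!EFinD; congr (_%:E); ring.
Qed.

(** The image measure multiplied by [k] gives each half-open interval its length, so it is Lebesgue
    measure by uniqueness. *)
Lemma lebesgue_measure_dilation (k : R) (A : set R) : (0 < k)%R -> measurable A ->
  mu ( *%R k @^-1` A) = k^-1%:E * mu A.
Proof.
move=> k0 mA.
have mf : measurable_fun [set: measurableTypeR R]
    ( *%R k : measurableTypeR R -> measurableTypeR R).
  exact: measurable_funM.
have k0' : (0 <= k)%R by exact: ltW.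
suff -> : mu A = k%:E * mu ( *%R k @^-1` A).
  by rewrite muleA -EFinM mulVf ?mul1e// gt_eqF.
apply: (lebesgue_measure_unique (mu := mscale (NngNum k0')
  (pushforward mu ( *%R k : measurableTypeR R -> measurableTypeR R)))) => //.
move=> _ [[a b]] _ <-; rewrite /= /mscale /= /pushforward.
have -> : *%R k @^-1` `]a, b]%classic = `](a / k)%R, (b / k)%R]%classic.
  by apply: eq_set => u /=; rewrite !in_itv /= ltr_pdivrMr// ler_pdivlMr// mulrC.
rewrite !lebesgue_measure_itv /= !lte_fin ltr_pM2r ?invr_gt0//.
case: ifP => [_|_]; last by rewrite mule0.
by rewrite -!EFinD -EFinM; congr (_%:E); field; rewrite gt_eqF.
Qed.

Let mid : measurable_fun setT (fun u : measurableTypeR R => u : R).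
Proof. exact: measurable_id. Qed.

Let mexp : measurable_fun setT (expR : measurableTypeR R -> R).
Proof. exact: measurable_expR. Qed.

(* lebesgue_measure lives on the type alias measurableTypeR R, while laws of
   random variables live on R itself; the image under the identity transports
   it. *)
Definition lebesgueR :=
  reference_measure mid (@measurable_id _ R setT) (fun=> erefl).

(** The measure dx / x on the positive axis, the Haar measure of the multiplicative group. *)
Definition log_lebesgue :=
  reference_measure mexp (@measurable_ln R) (@expRK R).

Lemma dilation_balanced_lebesgue : dilation_balanced lebesgueR.
Proof.
move=> k A B k0 mA mB.
rewrite /= /image_lebesgue /pushforward /=.
rewrite !lebesgue_measure_dilation ?invr_gt0// invrK muleACA -EFinM mulVf ?gt_eqF//.
by rewrite mul1e.
Qed.

(** In the logarithmic coordinate a dilation by [k] is a translation by [ln k], so each factor is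
    invariant separately. *)
Lemma dilation_balanced_log : dilation_balanced log_lebesgue.
Proof.
have inv (k : R) (A : set R) : (0 < k)%R -> measurable A ->
    log_lebesgue ( *%R k @^-1` A) = log_lebesgue A.
  move=> k0 mA; rewrite /= /image_lebesgue /pushforward.
  rewrite -[RHS](lebesgue_measure_translation (ln k)); last exact: measurable_preimageT.
  by congr mu; apply: eq_set => u /=; rewrite expRD lnK// mulrC.
by move=> k A B k0 mA mB; rewrite !inv ?invr_gt0.
Qed.

(** The reference measure is left open so that log-normal laws can be described relative to dx /
    x. *)
Definition log_concave_law (law : set R -> \bar R) : Prop :=
  exists (m : {sigma_finite_measure set R -> \bar R}) (f : R -> R),
  [/\ dilation_balanced m, measurable_fun setT f, (forall x, 0 <= f x)%R,
      mul_log_concave f &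
      forall A, measurable A -> law A = \int[m]_(x in A) (f x)%:E].

Lemma density_log_concave (law : set R -> \bar R) (f : R -> R) :
  has_density law f -> mul_log_concave f -> log_concave_law law.
Proof.
move=> [mf f0 lawE] cf; exists lebesgueR, f; split => //.
- exact: dilation_balanced_lebesgue.
- by move=> A mA; rewrite lawE// integral_reference_measure.
Qed.

End Invariance.

(** * The five families of laws *)

Section Laws.
Context (R : realType).
Implicit Types (law : set R -> \bar R) (f g h : R -> R).

Lemma on_pos_log_concave g : (forall x, 0 < x -> 0 <= g x) ->
  (forall k x y, 0 < k <= 1 -> 0 < x -> 0 < y -> k * y < x ->
    g (k * y) * g (x / k) <= g x * g y) -> mul_log_concave (on_pos g).
Proof.
move=> g0 cg k x y /[dup] /andP[k0 _] k1 kyx.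
have f0 z : 0 <= on_pos g z by rewrite /on_pos; case: ifP => // /g0.
rewrite {1 2}/on_pos pmulr_rgt0//; case: ifPn => [y0|]; last first.
  by rewrite mul0r mulr_ge0.
have x0 : 0 < x by apply: lt_trans kyx; rewrite mulr_gt0.
by rewrite divr_gt0// /on_pos x0 y0; exact: cg.
Qed.

Lemma scale_log_concave (c : R) f : mul_log_concave f ->
  mul_log_concave (fun y => c * f y).
Proof.
move=> cf k x y k1 kyx; rewrite mulrACA [leRHS]mulrACA.
by apply: ler_wpM2l; [rewrite -expr2 sqr_ge0|exact: cf].
Qed.

(** The powers of [k] cancel in the monomial factor. With [x = k * z] and [K = k ^ p], the exponents
    compare because [(1 - K) * (z ^ p - y ^ p)] is nonnegative. *)
Lemma powR_expR_log_concave (c q b p : R) : 0 <= c -> 0 <= b -> 0 <= p ->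
  mul_log_concave (on_pos (fun y => c * y `^ q * expR (- (b * y `^ p)))).
Proof.
move=> c0 b0 p0; apply: on_pos_log_concave => [x x0|k x y /andP[k0 k1] x0 y0 kyx].
  by rewrite !mulr_ge0 ?powR_ge0 ?expR_ge0.
rewrite mulrACA [leRHS]mulrACA -!expRD.
have -> : c * (k * y) `^ q * (c * (x / k) `^ q) = c * x `^ q * (c * y `^ q).
  rewrite !powRM ?invr_ge0 ?(ltW k0) ?(ltW x0) ?(ltW y0)//.
  have : k `^ q * k^-1 `^ q = 1.
    by rewrite -powRM ?invr_ge0 ?(ltW k0)// mulfV ?gt_eqF// powR1.
  move=> e; transitivity (c * x `^ q * (c * y `^ q) * (k `^ q * k^-1 `^ q)).
    by ring.
  by rewrite e mulr1.
apply: ler_wpM2l; first by rewrite !mulr_ge0 ?powR_ge0.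
rewrite ler_expR -!opprD lerN2 -!mulrDr; apply: ler_wpM2l => //.
set K := k `^ p.
have [z z0 xE] : exists2 z, 0 < z & x = k * z.
  by exists (x / k); [rewrite divr_gt0|rewrite mulrC divfK// gt_eqF].
have -> : x / k = z by rewrite xE mulrAC mulfV ?mul1r// gt_eqF.
have K1 : K <= 1.
  have -> : 1 = 1 `^ p :> R by rewrite powR1.
  by apply: ge0_ler_powR => //; rewrite nnegrE ltW.
have yz : y `^ p <= z `^ p.
  apply: ge0_ler_powR; rewrite ?nnegrE ?(ltW y0) ?(ltW z0)//.
  by move: kyx; rewrite xE ltr_pM2l// => /ltW.
rewrite xE !powRM ?(ltW k0) ?(ltW y0) ?(ltW z0)// -/K.
have : 0 <= (1 - K) * (z `^ p - y `^ p) by rewrite mulr_ge0 ?subr_ge0.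
by lra.
Qed.

Lemma uniform_log_concave law : is_uniform law -> log_concave_law law.
Proof.
move=> [s [s0 lawE]]; apply: (@density_log_concave _ _ (uniform_pdf 0 s)).
  split => //; first exact: measurable_uniform_pdf.
  by move=> y; exact: uniform_pdf_ge0.
move=> k x y /andP[k0 k1] kyx.
have pdf0 z : 0 <= uniform_pdf 0 s z by exact: uniform_pdf_ge0.
rewrite {1 2}/uniform_pdf; case: ifPn => [/andP[ky0 _]|]; last first.
  by move=> _; rewrite mul0r mulr_ge0.
case: ifPn => [/andP[_ xks]|]; last by move=> _; rewrite mulr0 mulr_ge0.
(* The left side is nonzero only if [k * y] and [x / k] lie in the support; then [x] and [y] lie
   between 0 and [x / k], where the density is constant. *)
have y0 : 0 <= y by rewrite -(pmulr_rge0 _ k0).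
have x0 : 0 <= x by apply: ltW; exact: le_lt_trans kyx.
have yx : y <= x / k by rewrite ler_pdivlMr// mulrC ltW.
have xx : x <= x / k by rewrite ler_pdivlMr// ler_piMr.
by rewrite /uniform_pdf x0 y0 (le_trans xx)// (le_trans yx).
Qed.

Lemma gamma_log_concave law : is_gamma law -> log_concave_law law.
Proof.
move=> [a [b [a0 b0 [c c0 lawE]]]]; apply: (density_log_concave lawE).
apply: scale_log_concave.
have := @powR_expR_log_concave 1 (a - 1) b 1 ler01 (ltW b0) ler01.
congr mul_log_concave; apply/funext => y; rewrite /on_pos; case: ifP => // y0.
by rewrite mul1r powRr1// ltW.
Qed.

Lemma weibull_log_concave law : is_weibull law -> log_concave_law law.
Proof.
move=> [p p0 lawE]; apply: (density_log_concave lawE).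
have := @powR_expR_log_concave p (p - 1) 1 p (ltW p0) ler01 (ltW p0).
by congr mul_log_concave; apply/funext => y; rewrite /on_pos mul1r.
Qed.

Lemma rayleigh_log_concave law :
  is_generalized_rayleigh law -> log_concave_law law.
Proof.
move=> [nu nu0 [c c0 lawE]]; apply: (density_log_concave lawE).
apply: scale_log_concave.
have := @powR_expR_log_concave 1 (nu - 1) 2^-1 2 ler01.
rewrite invr_ge0 !ler0n => /(_ isT isT).
congr mul_log_concave; apply/funext => y; rewrite /on_pos; case: ifP => // y0.
by rewrite mul1r powR_mulrn 1?ltW// mulrC [2^-1 * _]mulrC mulrC.
Qed.

Lemma lognormal_log_concave law : is_lognormal law -> log_concave_law law.
Proof.
move=> [m [s [s0 lawE]]].
(* Density relative to dx / x, which absorbs the Jacobian factor 1 / y. *)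
pose f := on_pos (fun y => normal_pdf m s (ln y)).
have sn0 : s != 0 by rewrite gt_eqF.
have mf : measurable_fun setT f.
  apply: measurable_fun_ifT => //=.
    exact: measurable_fun_ltr.
  exact: (measurableT_comp (measurable_normal_pdf m s) (@measurable_ln R)).
have f0 x : 0 <= f x.
  by rewrite /f /on_pos; case: ifP => // _; exact: normal_pdf_ge0.
exists (log_lebesgue R), f; split => //.
- exact: dilation_balanced_log.
- apply: on_pos_log_concave => [x _|k x y /andP[k0 k1] x0 y0 kyx].
    exact: normal_pdf_ge0.
  rewrite !lnM ?posrE ?invr_gt0// lnV ?posrE// normal_pdfE// /normal_fun.
  rewrite mulrACA [leRHS]mulrACA -!expRD.
  apply: ler_wpM2l; first by rewrite mulr_ge0 ?normal_peak_ge0.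
  rewrite ler_expR -!mulrDl; apply: ler_wpM2r.
    by rewrite invr_ge0 mulrn_wge0 ?sqr_ge0.
  (* The two sums of squares differ by [2 * ln k * (ln k + ln y - ln x)], a product of two
     nonpositive factors up to the constant. *)
  have lnk : ln k <= 0 by exact: ln_le0.
  have lnyx : ln k + ln y <= ln x.
    by rewrite -lnM ?posrE// ler_ln ?posrE ?mulr_gt0// ltW.
  by nra.
- move=> A mA; rewrite lawE// integral_reference_measure//.
  rewrite /pushforward /normal_prob; apply: eq_integral => u _.
  by rewrite /f /on_pos expR_gt0 expRK.
Qed.

End Laws.

(** * The two-coordinate transfer inside the full sum, and the conclusion *)

Section Transfer.
Context (R : realType) (d : measure_display) (T : measurableType d).
Context (P : probability T R) (n : nat) (Y : 'I_n -> {RV P >-> R}).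
Local Open Scope ereal_scope.

(** For each value [u] of the remaining sum, the pair faces a half-plane with threshold [t - u],
    which [sum2_le] compares. Equal sums of logarithms become equal products of coefficients. *)
Lemma lin_comb_transfer (t : R) : iid Y ->
  (forall i, log_concave_law (distribution P (Y i))) ->
  transfer_monotone (fun x => P (lin_comb Y (fun i => expR (x i)) (enum 'I_n)
    @^-1` [set r | r <= t]%R)).
Proof.
move=> [indepY idY] lc i j x y ij xy sumxy xi xj.
pose s := [seq k <- enum 'I_n | (k != i) && (k != j)].
have us : uniq s by rewrite filter_uniq// enum_uniq.
have si : i \notin s by rewrite mem_filter eqxx.
have sj : j \notin s by rewrite mem_filter eqxx andbF.
pose c k := expR (x k).
pose halfspace (a1 a2 : R) := [set z : R * (R * R) |
  (z.1 + (a1 * z.2.1 + a2 * z.2.2) <= t)%R].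
have mhalf a1 a2 : measurable (halfspace a1 a2).
  apply: (@measurable_preimageT _ _ _ _
    (fun z : R * (R * R) => z.1 + (a1 * z.2.1 + a2 * z.2.2))%R `]-oo, t]%classic).
    apply: measurable_funD => //; apply: measurable_funD; apply: measurable_funM => //.
      exact: (measurableT_comp measurable_fst measurable_snd).
    exact: (measurableT_comp measurable_snd measurable_snd).
  exact: measurable_itv.
have splitE (z : 'I_n -> R) : (forall k, k != i -> k != j -> x k = z k) ->
    lin_comb Y (fun i => expR (z i)) (enum 'I_n) @^-1` [set r | r <= t]%R =
    (fun w => (lin_comb Y c s w, pair_rv Y i j w)) @^-1`
      halfspace (expR (z i)) (expR (z j)).
  move=> xz; apply: eq_set => w /=; congr (is_true (_ <= t)%R).
  rewrite /lin_comb big_enum/= (bigD1 i)//= (bigD1 j)/=; last by rewrite eq_sym.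
  rewrite big_filter big_enum_cond/= addrCA addrA addrC; congr (_ + _)%R.
    by apply: eq_bigr => k /andP[ki kj]; rewrite /c xz.
  exact: addrC.
rewrite (splitE x)// (splitE y)//.
(* Used instead of rewriting with [law]: matching its left-hand side against
   [_ \x _] sends unification astray. *)
have leE (p q p' q' : \bar R) : p = p' -> q = q' -> p' <= q' -> p <= q.
  by move=> -> ->.
have law a1 a2 := triple_law c indepY us si sj ij (mhalf a1 a2).
apply: (leE _ _ _ _ (law _ _) (law _ _)).
pose YY : {mfun T >-> (R * R)%type} := HB.pack (pair_rv Y i j)
  (isMeasurableFun.Build _ _ _ _ _ (measurable_pair_rv Y i j)).
have mS := measurable_lin_comb Y c s.
pose S : {mfun T >-> R} := HB.pack (lin_comb Y c s) (isMeasurableFun.Build _ _ _ _ _ mS).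
(* One choice of [m] and [f], made at [i], must serve both variables; identical distribution carries
   it to [j]. *)
have [m [f [bal mf f0 cf lawE]]] := lc i.
have lawjE A : measurable A -> distribution P (Y j) A = \int[m]_(r in A) (f r)%:E.
  by move=> mA; rewrite (idY j i)// lawE.
have mX (A : set (R * (R * R))) : measurable A ->
    measurable_fun setT (pushforward P (pair_rv Y i j) \o xsection A).
  exact: (@measurable_fun_xsection _ _ _ _ _ (distribution P YY) A).
(* A product measure is by definition the integral of the measures of sections, so a comparison
   section by section suffices. *)
apply: (@ge0_le_integral _ _ _ (distribution P S)) => //.
- by move=> u _; rewrite /= /pushforward; exact: measure_ge0.
- exact: mX.
- exact: mX.
move=> u _.
have secE a1 a2 : xsection (halfspace a1 a2) u =
    [set z : R * R | (a1 * z.1 + a2 * z.2 <= t - u)%R].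
  by apply/seteqP; split => z; rewrite /xsection/= inE/= lerBrDl.
have plaw a1 a2 := pair_law indepY ij (measurable_xsection u (mhalf a1 a2)).
apply: (leE _ _ _ _ (plaw _ _) (plaw _ _)).
rewrite !secE; apply: (@sum2_le _ m f
  (distribution P (Y i)) (distribution P (Y j))); rewrite ?expR_gt0//.
- by rewrite -!expRD sumxy.
- by rewrite ler_expR.
- by rewrite ler_expR.
Qed.

End Transfer.

Lemma sum_mfunE (R : realType) (d : measure_display) (T : measurableType d)
    (I : Type) (s : seq I) (F : I -> {mfun T >-> R}) (w : T) :
  (\sum_(i <- s) F i : {mfun T >-> R}) w = \sum_(i <- s) F i w.
Proof.
by elim: s => [|i s IH]; rewrite ?big_nil ?big_cons//= -IH.
Qed.

Theorem corollary1 (R : realType) (d : measure_display) (T : measurableType d)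
    (P : probability T R) (n : nat) (Y : 'I_n -> {RV P >-> R}) :
  (1 <= n)%N ->
  iid Y ->
  (forall i, is_uniform (distribution P (Y i))) \/
  (forall i, is_gamma (distribution P (Y i))) \/
  (forall i, is_lognormal (distribution P (Y i))) \/
  (forall i, is_weibull (distribution P (Y i))) \/
  (forall i, is_generalized_rayleigh (distribution P (Y i))) ->
  forall a b : 'I_n -> R, (forall i, 0 < a i) -> (forall i, 0 < b i) ->
  majorized (fun i => ln (a i)) (fun i => ln (b i)) ->
  st_le (P1 := P) (P2 := P) (\sum_(i < n) a i *: (Y i : {mfun T >-> R}))
        (\sum_(i < n) b i *: (Y i : {mfun T >-> R})).
Proof.
move=> _ iidY laws a b a0 b0 maj t.
have lc i : log_concave_law (distribution P (Y i)).
  case: laws => [h|[h|[h|[h|h]]]].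
  - exact: uniform_log_concave.
  - exact: gamma_log_concave.
  - exact: lognormal_log_concave.
  - exact: weibull_log_concave.
  - exact: rayleigh_log_concave.
(* Writing each coefficient as the exponential of its logarithm turns the distribution function into
   a function of the majorized vectors. *)
have cdfE (z : 'I_n -> R) : (forall i, 0 < z i) ->
    cdf (\sum_(i < n) z i *: (Y i : {mfun T >-> R}) : {RV P >-> R}) t =
    P (lin_comb Y (fun i => expR (ln (z i))) (enum 'I_n) @^-1` [set r | r <= t]).
  move=> z0; rewrite /cdf /distribution /pushforward; congr (P _).
  apply: eq_set => w /=; rewrite in_itv/=; congr (is_true (_ <= t)).
  rewrite sum_mfunE /lin_comb big_enum/=; apply: eq_bigr => i _.
  by rewrite lnK// posrE.
(* Complementation reverses the inequality, so the distribution function for [b] must lie below that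
   for [a]. *)
rewrite !ccdf_1_cdf leeB// !cdfE//.
exact: (majorized_le (lin_comb_transfer t iidY lc) maj).
Qed.
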